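(* Every regular normal extremal that is time-optimal for the problem below has at most two switching times, i.e. consists of at most three arcs. Moreover its bang pattern (ordered sequence of arc types) is either $X$ or $X\,Y\,X$; in particular, the only pattern with at least one switching is $XYX$ (global–local–global).
   Context: Fix $\gamma\in(0,\pi/2)$, $s=\sin\gamma$, $c=\cos\gamma$, and $X=\begin{pmatrix}0&s^2&sc\\-s^2&0&0\\-sc&0&0\end{pmatrix}$ (continuous-limit generator of the global Grover operator), $Y=\begin{pmatrix}0&1&0\\-1&0&0\\0&0&0\end{pmatrix}$ (generator of the local Grover operator), acting on $\mathbb R^3$ with standard basis $e_1,e_2,e_3$ and standard inner product. Let $\Sigma=\{\psi:\langle e_3,\psi\rangle=0\}$, $\psi_0=(0,s,c)^\top$. Time-optimal problem: over piecewise constant controls $A:[0,T]\to\{X,Y\}$ with finitely many discontinuities (switching times) and trajectories $\dot\psi=A(t)\psi$, $\psi(0)=\psi_0$, minimize $T$ subject to $\psi(T)\in\Sigma$. Maximal intervals on which $A\equiv X$ (resp. $Y$) are $X$-arcs (resp. $Y$-arcs). A normal extremal is such a trajectory with a nonzero absolutely continuous costate $p$ satisfying $\dot p=-A(t)^\top p$ and, for a.e. $t$, $\langle p,A(t)\psi\rangle-1=\max_{B\in\{X,Y\}}(\langle p,B\psi\rangle-1)$. Let $F_1=X-Y$, $F_2=[X,Y]$, $\phi_1=\langle p,F_1\psi\rangle$ (the switching function), $\phi_2=\langle p,F_2\psi\rangle$. A normal extremal is regular (bang–bang) if $\phi_1$ vanishes only at isolated times and at every switching time $\phi_1=0$ and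 $\phi_2\neq0$. *)

(* Defs.v *)
From HB Require Import structures.
From mathcomp Require Import all_boot all_order all_algebra.
From mathcomp Require Import all_classical all_reals all_analysis.
Set Implicit Arguments. Unset Strict Implicit. Unset Printing Implicit Defensive.
Import Order.TTheory GRing.Theory Num.Theory.
Import numFieldNormedType.Exports.
Local Open Scope ring_scope.

Section Grover.
Variable R : realType.

Definition ip (u v : 'cV[R]_3) : R := \sum_(i < 3) u i 0 * v i 0.

Definition e3 : 'cV[R]_3 := \col_(i < 3) (i == 2%N :> nat)%:R.

Definition Xmat (g : R) : 'M[R]_3 :=
  \matrix_(i < 3, j < 3)
    match nat_of_ord i, nat_of_ord j with
    | 0%N, 1%N => sin g ^+ 2
    | 0%N, 2%N => sin g * cos g
    | 1%N, 0%N => - sin g ^+ 2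
    | 2%N, 0%N => - (sin g * cos g)
    | _, _ => 0
    end.

Definition Ymat : 'M[R]_3 :=
  \matrix_(i < 3, j < 3)
    match nat_of_ord i, nat_of_ord j with
    | 0%N, 1%N => 1
    | 1%N, 0%N => -1
    | _, _ => 0
    end.

Definition psi0 (g : R) : 'cV[R]_3 := \col_(i < 3)
    match nat_of_ord i with 0%N => 0 | 1%N => sin g | _ => cos g end.

Definition inSigma (v : 'cV[R]_3) : Prop := ip e3 v = 0.

Definition F1 (g : R) : 'M[R]_3 := Xmat g - Ymat.
Definition F2 (g : R) : 'M[R]_3 := Xmat g *m Ymat - Ymat *m Xmat g.

Definition abs_cont_on (a b : R) (f : R -> R) : Prop :=
  forall e : R, 0 < e -> exists2 d : R, 0 < d &
    forall (n : nat) (l r : 'I_n -> R),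
      (forall i, [/\ a <= l i, l i <= r i & r i <= b]) ->
      (forall i j, i != j -> r i <= l j \/ r j <= l i) ->
      \sum_(i < n) (r i - l i) < d ->
      \sum_(i < n) `|f (r i) - f (l i)| < e.

Definition solves (T : R) (M : R -> 'M[R]_3) (x : R -> 'cV[R]_3) : Prop :=
  (forall i : 'I_3, abs_cont_on 0 T (fun t => x t i 0)) /\
  {ae (@lebesgue_measure R), forall t, t \in `[0, T] ->
     forall i : 'I_3, derivable (fun u => x u i 0) t 1 /\
       derive1 (fun u => x u i 0) t = (M t *m x t) i 0}.

(* A piecewise constant control with values in {X, Y} on [0,T] with finitely
   many discontinuities is given by times 0 < t_1 < ... < t_k < T and labels
   b_0, ..., b_k (true = X, false = Y); on (t_i, t_{i+1}) the control is b_i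
   (with t_0 = 0, t_{k+1} = T).  Values at the finitely many times t_i are
   irrelevant (measure zero). *)
Definition admissible (T : R) (ts : seq R) (bs : seq bool) : Prop :=
  [/\ 0 <= T, size bs = (size ts).+1, path <%R 0 ts & all (fun s => s < T) ts].

Definition label (ts : seq R) (bs : seq bool) (t : R) : bool :=
  nth false bs (count (fun s => s < t) ts).

Definition ctrl (g : R) (ts : seq R) (bs : seq bool) (t : R) : 'M[R]_3 :=
  if label ts bs t then Xmat g else Ymat.

(* the t_i are exactly the switching times and the b_i the types of the
   maximal arcs: consecutive labels differ *)
Definition alternating (bs : seq bool) : Prop :=
  forall i : nat, (i.+1 < size bs)%N -> nth false bs i != nth false bs i.+1.

Definition trajectory (g T : R) ts bs (psi : R -> 'cV[R]_3) : Prop :=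
  admissible T ts bs /\ solves T (ctrl g ts bs) psi /\ psi 0 = psi0 g.

Definition time_optimal (g T : R) : Prop :=
  forall (T' : R) ts' bs' (psi' : R -> 'cV[R]_3),
    trajectory g T' ts' bs' psi' -> inSigma (psi' T') -> T <= T'.

Definition normal_extremal (g T : R) ts bs (psi p : R -> 'cV[R]_3) : Prop :=
  [/\ trajectory g T ts bs psi /\ alternating bs, inSigma (psi T),
      solves T (fun t => - (ctrl g ts bs t)^T) p,
      ~ (forall t, t \in `[0, T] -> p t = 0) &
      {ae (@lebesgue_measure R), forall t, t \in `[0, T] ->
         ip (p t) (ctrl g ts bs t *m psi t) - 1 =
         Num.max (ip (p t) (Xmat g *m psi t) - 1)
                 (ip (p t) (Ymat *m psi t) - 1)}].

Definition phi1 (g : R) (psi p : R -> 'cV[R]_3) (t : R) : R :=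
  ip (p t) (F1 g *m psi t).
Definition phi2 (g : R) (psi p : R -> 'cV[R]_3) (t : R) : R :=
  ip (p t) (F2 g *m psi t).

Definition regular (g T : R) (ts : seq R) (psi p : R -> 'cV[R]_3) : Prop :=
  (forall t, t \in `[0, T] -> phi1 g psi p t = 0 ->
     exists2 e : R, 0 < e & forall u, u \in `[0, T] -> 0 < `|u - t| < e ->
       phi1 g psi p u != 0) /\
  (forall s, s \in ts -> phi1 g psi p s = 0 /\ phi2 g psi p s != 0).

End Grover.

(* Main.v *)
Require Import Defs.
From mathcomp Require Import all_boot all_order all_algebra.
From mathcomp Require Import all_classical all_reals all_analysis.
From mathcomp Require Import measurable_realfun ring lra.
Set Implicit Arguments.
Unset Strict Implicit.
Unset Printing Implicit Defensive.
Import Order.TTheory GRing.Theory Num.Theory.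
Import numFieldNormedType.Exports.
Local Open Scope ring_scope.
Local Open Scope classical_set_scope.

(** Put [s = sin g], [c = cos g], [u = psi0 = (0, s, c)] and
    [n = X_axis = (0, c, -s)].  The generator X rotates the plane [(e1, u)] with
    speed [s] and kills [n], and [X - Y = c (n e1^T - e1 n^T)].  Hence [phi1]
    vanishes at time [0], and on an X-arc that starts at a zero [t0] of [phi1] it
    is a multiple of [sin (s (t - t0))]; since its zeros are isolated, an X-arc
    that ends with a switching lasts at least [pi / s].  But the pure X trajectory
    reaches Sigma at time [pi / (2 s)], so in an optimal extremal every arc that
    ends with a switching is a Y-arc, and as arcs alternate the pattern is X, Y or
    YX.  The generator Y conserves the height [e3], which rules out Y.  For YX,
    the height after a Y-arc of length [x] and an X-arc of length [t] is, up to
    the factor [c], at least [cos (s t) - s sin x sin (s t)]; while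
    [s (x + t) <= pi / 2], this is positive because
    [s sin x <= sin (s x) <= cos (s t)] and [sin (s t) < 1]. *)

Section null_derivative.
Variable R : realType.
Local Notation mu := (@lebesgue_measure R).
Implicit Types (a b t l d e : R) (f : R -> R).

Definition holds_straddling (C : R -> R -> Prop) t := exists2 d : R, 0 < d &
  forall u v, t - d < u <= t -> t <= v < t + d -> C u v.

Lemma cousin (C : R -> R -> Prop) a b : a <= b ->
  (forall t, a <= t <= b -> holds_straddling C t) ->
  exists2 s, itv_partition a b s & path (fun u v => `[< C u v >]) a s.
Proof.
move=> ab Cab; pose P t := exists2 s, itv_partition a t s &
  path (fun u v => `[< C u v >]) a s.
have Pa : P a by exists [::] => //; split => //=.
have Pext u v : C u v -> u < v -> P u -> P v.
  move=> Cuv uv [s [lts /eqP lasts] Cs].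
  exists (rcons s v); last by rewrite rcons_path Cs lasts; apply/asboolP.
  by split; rewrite ?last_rcons// rcons_path lts lasts.
pose S := [set t | a <= t <= b /\ P t].
have Sa : S a by split => //; rewrite lexx ab.
have supS : has_sup S by split; [exists a | exists b => t [/andP[]]].
have aS : a <= sup S by apply: ub_le_sup Sa; case: supS.
have Sb : sup S <= b by apply: ge_sup; [exists a | move=> t [/andP[]]].
have [|d d0 Cd] := Cab (sup S); first by rewrite aS.
have [u [/andP[au ub] Pu] du] := sup_adherent d0 supS.
have uS : u <= sup S by apply: ub_le_sup; [case: supS|split => //; rewrite au].
have Pv v : sup S <= v -> v < sup S + d -> P v.
  move=> Sv vd; have [->//|uv] := eqVneq v u.
  apply: (Pext u) => //; first by apply: Cd; rewrite ?du ?uS ?Sv.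
  by rewrite lt_neqAle eq_sym uv (le_trans uS).
have [bd|db] := ltP b (sup S + d); first exact: Pv.
have : S (sup S + d / 2) by split; [apply/andP; split|apply: Pv]; lra.
by move=> /(ub_le_sup (proj2 supS)); lra.
Qed.

Lemma is_derive_straddle f (df : R) t e : is_derive t 1 f df -> 0 < e ->
  holds_straddling (fun u v => `|f v - f u - df * (v - u)| <= e * (v - u)) t.
Proof.
move=> [/cvg_ex[l fl]] dfE e0.
have {dfE} ldf : l = df by rewrite -dfE; apply/esym/cvg_lim.
have /cvgrPdist_le/(_ _ e0)/nbhs_ballP[d /= d0 fd] := fl.
have f_near h : `|h| < d -> `|f (t + h) - f t - df * h| <= e * `|h|.
  have [->|h0 hd] := eqVneq h 0.
    by rewrite addr0 subrr !mulr0 subr0 !normr0 mulr0.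
  have := fd h; rewrite /ball/= sub0r normrN => /(_ hd h0).
  rewrite scaler1 -(ler_pM2r (_ : 0 < `|h|)) ?normr_gt0// -normrM mulrBl ldf.
  by rewrite /GRing.scale/= mulrAC mulVf// mul1r distrC (addrC h).
exists d => // u v /andP[du ut] /andP[tv vd].
have -> : f v - f u - df * (v - u) = (f (t + (v - t)) - f t - df * (v - t))
    - (f (t + (u - t)) - f t - df * (u - t)) by rewrite !subrKC; ring.
rewrite (le_trans (ler_normB _ _))//.
have := f_near (v - t); have := f_near (u - t).
rewrite (ler0_norm (_ : u - t <= 0)) ?subr_le0//.
rewrite (ger0_norm (_ : 0 <= v - t)) ?subr_ge0//.
move=> /(_ ltac:(lra)) + /(_ ltac:(lra)); lra.
Qed.

Lemma negligible_open_cover (N : set R) e : mu.-negligible N -> 0 < e ->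
  exists U : set R, [/\ open U, N `<=` U & (mu U < e%:E)%E].
Proof.
move=> [A [mA A0 NA]] e0.
have muA : (mu A < +oo)%E by rewrite A0 ltry.
have [U [oU AU mUA]] := lebesgue_regularity_outer mA muA e0.
exists U; split => //; first exact: subset_trans AU.
have mUD : measurable (U `\` A) by apply: measurableD => //; exact: open_measurable.
rewrite -(setDUK AU); apply: le_lt_trans mUA.
apply: le_trans (measureU2 _ mA mUD) _.
by rewrite [X in (X + _)%E](_ : _ = 0%E) ?add0e.
Qed.

Lemma sum_length_le_lebesgue_measure (U : set R) n (l r : 'I_n -> R) :
  measurable U -> (forall i, l i <= r i) -> (forall i, `]l i, r i] `<=` U) ->
  (forall i j, i != j -> r i <= l j \/ r j <= l i) ->
  ((\sum_(i < n) (r i - l i))%:E <= mu U)%E.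
Proof.
move=> mU lr lrU disj.
have -> : (\sum_(i < n) (r i - l i))%:E = mu (\big[setU/set0]_(i < n) `]l i, r i]).
  rewrite measure_bigsetU_ord//; last first.
    apply/trivIsetP => i j _ _ ij; apply/seteqP; split => // x [] /=.
    by rewrite !in_itv/= => /andP[lx xr] /andP[lx' xr']; have [] := disj _ _ ij; lra.
  rewrite -sumEFin; apply: eq_bigr => i _ /=.
  rewrite lebesgue_measure_itv/= lte_fin; case: ltP => // ril.
  by congr (_%:E); apply/eqP; rewrite subr_eq0 eq_le ril lr.
rewrite le_measure ?inE//; first exact: bigsetU_measurable.
by apply: (big_ind (fun A : set R => A `<=` U)) => // A B ? ?; rewrite subUset.
Qed.

Lemma abs_cont_on_variation_lt (a b : R) f e : abs_cont_on a b f -> 0 < e ->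
  exists2 d : R, 0 < d & forall (U : set R) s, measurable U -> (mu U < d%:E)%E ->
    itv_partition a b s ->
    \sum_(i < size s | `[< `]nth b (a :: s) i, nth b (a :: s) i.+1] `<=` U >])
      `|f (nth b (a :: s) i.+1) - f (nth b (a :: s) i)| < e.
Proof.
move=> acf e0; have [d d0 acd] := acf _ e0; exists d => // U s mU Ud ps.
pose x := nth b (a :: s).
have x_le i j : (i <= j <= size s)%N -> x i <= x j.
  have lts : sorted <%R (a :: s) by case: ps.
  by move=> /andP[ij js]; rewrite lt_sorted_leq_nth// inE ltnS// (leq_trans ij).
pose r (i : 'I_(size s)) := if `[< `]x i, x i.+1] `<=` U >] then x i.+1 else x i.
have xr (i : 'I_(size s)) : x i <= r i <= x i.+1.
  by rewrite /r; case: ifP; rewrite lexx ?andbT /= x_le// leqnSn/=.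
have disj i j : i != j -> r i <= x j \/ r j <= x i.
  suff lt_disj (i' j' : 'I_(size s)) : (i' < j')%N -> r i' <= x j'.
    by rewrite neq_ltn => /orP[] /lt_disj; [left|right].
  move=> ij; have /andP[_ /le_trans->//] := xr i'.
  by rewrite x_le// ij ltnW.
rewrite big_mkcond/= (eq_bigr (fun i => `|f (r i) - f (x i)|)); last first.
  by move=> i _; rewrite /r; case: ifP => // _; rewrite subrr normr0.
apply: (acd _ (fun i => x i)) => //.
  move=> i; have /andP[? ri] := xr i; split=> //.
    by rewrite (itv_partition_nth_ge _ ps)// ltnS ltnW.
  by rewrite (le_trans ri)// (itv_partition_nth_le _ ps)// ltnS.
rewrite -lte_fin (le_lt_trans _ Ud)// sum_length_le_lebesgue_measure// => i.
  by have /andP[] := xr i.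
by rewrite /r; case: ifPn => [/asboolP//|_ y /=]; rewrite in_itv/=; lra.
Qed.

Lemma itv_partition_small_slope (U : set R) (a b : R) f e : a <= b -> 0 < e ->
  open U -> [set a; b] `<=` U ->
  (forall t, t \in `]a, b[%R -> ~ U t -> is_derive t 1 f 0) ->
  exists2 s, itv_partition a b s &
    path (fun u v => `[< `]u, v] `<=` U \/ `|f v - f u| <= e * (v - u) >]) a s.
Proof.
move=> ab e0 oU abU df; apply: cousin => // t tab.
have [Ut|nUt] := pselect (U t).
  have /nbhs_ballP[r /= r0 rU] := open_nbhs_nbhs (conj oU Ut).
  exists r => // u v /andP[ru _] /andP[_ vr]; left => x /=; rewrite in_itv/= => ?.
  by apply: rU; rewrite /ball/= ltr_distlC; lra.
have [|r r0 fr] := is_derive_straddle (df t _ nUt) e0; last first.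
  by exists r => // u v ut tv; right; have := fr u v ut tv; rewrite mul0r subr0.
rewrite in_itv/= !lt_neqAle; move: tab => /andP[-> ->]; rewrite !andbT.
by apply/andP; split; apply: contra_notN nUt => /eqP E; apply: abU; [left|right].
Qed.

(* Cover the exceptional null set by a small open set: by Cousin's lemma [a, b]
   splits into intervals on which f has small slope and intervals inside the
   cover, whose contribution absolute continuity bounds. *)
Lemma abs_cont_on_derive0_cst (a b : R) f : a <= b -> abs_cont_on a b f ->
  {ae mu, forall t, t \in `]a, b[%R -> is_derive t 1 f 0} -> f b = f a.
Proof.
move=> ab acf df; apply/eqP; rewrite -subr_eq0 -normr_le0.
apply/ler_addgt0Pr => e e0; rewrite add0r.
pose e' := e / (1 + (b - a)); have e'0 : 0 < e' by rewrite divr_gt0//; lra.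
have [d d0 acd] := abs_cont_on_variation_lt acf e'0.
have [U [oU NabU Ud]] : exists U : set R, [/\ open U,
    [set t | ~ (t \in `]a, b[%R -> is_derive t 1 f 0)] `|` [set a; b] `<=` U &
    (mu U < d%:E)%E].
  apply: negligible_open_cover => //.
  have neg1 x : mu.-negligible [set x].
    by exists [set x]; split => //; exact: lebesgue_measure_set1.
  by apply: negligibleU => //; exact: negligibleU.
move: NabU; rewrite subUset => -[NU abU].
have [|s ps Cs] := itv_partition_small_slope (f := f) ab e'0 oU abU.
  by move=> t tab nUt; apply: contrapT => ndf; apply/nUt/NU => /= /(_ tab).
pose x := nth b (a :: s); have xb : x (size s) = b by exact: itv_partition_nth_size.
pose inU i := `[< `]x i, x i.+1] `<=` U >].
have fx i : (i < size s)%N -> `|f (x i.+1) - f (x i)| <=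
    (if inU i then `|f (x i.+1) - f (x i)| else 0) + e' * (x i.+1 - x i).
  move=> si; have xi : 0 <= x i.+1 - x i.
    by rewrite subr_ge0 ltW//; case: ps => /(pathP b)/(_ i si).
  rewrite /inU; case: asboolP => [_|nU]; first by rewrite lerDl mulr_ge0// ltW.
  by have /(pathP b)/(_ i si)/asboolP[/nU//|] := Cs; rewrite add0r.
have -> : f b - f a = \sum_(0 <= i < size s) (f (x i.+1) - f (x i)).
  by rewrite (telescope_sumr (f \o x))//= xb.
rewrite big_mkord (le_trans (ler_norm_sum _ _ _))//.
apply: (@le_trans _ _ (\sum_(i < size s)
    ((if inU i then `|f (x i.+1) - f (x i)| else 0) + e' * (x i.+1 - x i)))).
  by apply: ler_sum => i _; exact: fx.
rewrite big_split/= -mulr_sumr -(big_mkord xpredT (fun i => x i.+1 - x i)).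
rewrite telescope_sumr// xb -big_mkcond/=.
have -> : e = e' + e' * (b - a) by rewrite /e'; field; lra.
by rewrite lerD2r ltW//; apply: acd Ud ps; exact: open_measurable.
Qed.

End null_derivative.

Section absolute_continuity.
Variable R : realType.
Implicit Types (a b k : R) (f g : R -> R).

Lemma abs_cont_onS a b a' b' f : a <= a' -> b' <= b ->
  abs_cont_on a b f -> abs_cont_on a' b' f.
Proof.
move=> aa bb acf e /acf[d d0 acd]; exists d => // n l r lr; apply: acd => i.
by have [? ? ?] := lr i; split => //; [exact: le_trans aa _|exact: le_trans bb].
Qed.

Lemma abs_cont_on_continuous a b f : abs_cont_on a b f ->
  {within `[a, b], continuous f}.
Proof.
move=> acf; apply/subspace_continuousP => x /=; rewrite in_itv/= => /andP[ax xb].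
apply/cvgrPdist_lt => e e0; have [d d0 acd] := acf _ e0.
have fxy u v : a <= u -> u <= v -> v <= b -> v - u < d -> `|f v - f u| < e.
  move=> au uv vb vud; have := acd 1%N (fun=> u) (fun=> v); rewrite !big_ord1.
  by apply => // i j; rewrite !ord1 eqxx.
apply/nbhs_ballP; exists d => //= y; rewrite /ball/= in_itv/= => xyd /andP[ay yb].
have [xy|/ltW yx] := leP x y.
  by rewrite distrC; apply: fxy => //; rewrite distrC ger0_norm ?subr_ge0// in xyd.
by apply: fxy => //; rewrite ger0_norm ?subr_ge0// in xyd.
Qed.

Lemma abs_cont_on_bounded a b f : abs_cont_on a b f ->
  exists2 M : R, 0 < M & forall t, a <= t <= b -> `|f t| <= M.
Proof.
move=> /abs_cont_on_continuous/continuous_compact/(_ (@segment_compact _ a b)).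
move=> /compact_bounded/pinfty_ex_gt0[M /= M0 fM]; exists M => // t tab.
by apply: fM; exists t.
Qed.

Lemma abs_cont_onD a b f g : abs_cont_on a b f -> abs_cont_on a b g ->
  abs_cont_on a b (fun t => f t + g t).
Proof.
move=> acf acg e e0; have e20 : 0 < e / 2 by lra.
have [d1 d10 acd1] := acf _ e20; have [d2 d20 acd2] := acg _ e20.
exists (Num.min d1 d2); first by rewrite lt_min d10.
move=> n l r lr disj; rewrite lt_min => /andP[s1 s2].
have := ltrD (acd1 n l r lr disj s1) (acd2 n l r lr disj s2).
rewrite -splitr -big_split/=; apply: le_lt_trans; apply: ler_sum => i _.
by rewrite opprD addrACA ler_normD.
Qed.

Lemma abs_cont_onM a b f g : abs_cont_on a b f -> abs_cont_on a b g ->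
  abs_cont_on a b (fun t => f t * g t).
Proof.
move=> acf acg.
have [M M0 fM] := abs_cont_on_bounded acf.
have [K K0 gK] := abs_cont_on_bounded acg.
move=> e e0.
have [d1 d10 acd1] := acf _ (divr_gt0 e0 (mulr_gt0 (ltr0n _ 2) K0)).
have [d2 d20 acd2] := acg _ (divr_gt0 e0 (mulr_gt0 (ltr0n _ 2) M0)).
exists (Num.min d1 d2); first by rewrite lt_min d10.
move=> n l r lr disj; rewrite lt_min => /andP[s1 s2].
apply: (@le_lt_trans _ _ (\sum_(i < n) (K * `|f (r i) - f (l i)|
    + M * `|g (r i) - g (l i)|))).
  apply: ler_sum => i _; have [al lri rb] := lr i.
  have -> : f (r i) * g (r i) - f (l i) * g (l i) =
    g (r i) * (f (r i) - f (l i)) + f (l i) * (g (r i) - g (l i)) by ring.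
  rewrite (le_trans (ler_normD _ _))// !normrM.
  by apply: lerD; apply: ler_wpM2r => //; [apply: gK|apply: fM]; lra.
rewrite big_split/= -!mulr_sumr.
have -> : e = K * (e / (2 * K)) + M * (e / (2 * M)).
  by field; rewrite !gt_eqF.
by apply: ltrD; rewrite ltr_pM2l//; [exact: acd1|exact: acd2].
Qed.

Lemma is_derive_MVT a b f (df : R -> R) : a <= b ->
  (forall x : R, is_derive x 1 f (df x)) ->
  exists2 c, c \in `[a, b]%R & f b - f a = df c * (b - a).
Proof.
move=> ab dfE; apply: MVT_segment => //; apply: continuous_subspaceT => x.
exact/differentiable_continuous/derivable1_diffP/ex_derive.
Qed.

Lemma abs_cont_on_bounded_derive a b f (df : R -> R) (K : R) :
  (forall x : R, is_derive x 1 f (df x)) -> (forall x, `|df x| <= K) ->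
  abs_cont_on a b f.
Proof.
move=> dfE dfK e e0.
have K0 : 0 <= K by apply: le_trans (dfK 0).
have lip x y : x <= y -> `|f y - f x| <= K * (y - x).
  move=> xy; have [c _ ->] := is_derive_MVT xy dfE.
  by rewrite normrM ler_pM// ger0_norm// subr_ge0.
exists (e / (K + 1)); first by rewrite divr_gt0//; lra.
move=> n l r lr _; rewrite ltr_pdivlMr; last by lra.
apply: le_lt_trans; rewrite mulr_suml; apply: ler_sum => i _.
by have [_ lri _] := lr i; have := lip _ _ lri; lra.
Qed.

Lemma abs_cont_on_cst a b k : abs_cont_on a b (fun=> k).
Proof.
by apply: (@abs_cont_on_bounded_derive _ _ _ (fun=> 0) 0) => x; rewrite ?normr0.
Qed.

Lemma abs_cont_on_sum a b (I : Type) (s : seq I) (F : I -> R -> R) :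
  (forall i, abs_cont_on a b (F i)) ->
  abs_cont_on a b (fun t => \sum_(i <- s) F i t).
Proof.
move=> acF; elim: s => [|i s ih].
  by under eq_fun do rewrite big_nil; exact: abs_cont_on_cst.
by under eq_fun do rewrite big_cons; exact: abs_cont_onD (acF i) ih.
Qed.

Lemma is_derive_cosM k (t : R) :
  is_derive t 1 (fun x => cos (k * x)) (- (k * sin (k * t))).
Proof.
have := is_derive1_comp (is_derive_cos _) (is_deriveZ k (is_derive_id t 1)).
by move=> /is_derive_eq; apply; rewrite /GRing.scale/= mulr1 mulNr mulrC.
Qed.

Lemma is_derive_sinM k (t : R) :
  is_derive t 1 (fun x => sin (k * x)) (k * cos (k * t)).
Proof.
have := is_derive1_comp (is_derive_sin _) (is_deriveZ k (is_derive_id t 1)).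
by move=> /is_derive_eq; apply; rewrite /GRing.scale/= mulr1 mulrC.
Qed.

Lemma abs_cont_on_cosM k a b : abs_cont_on a b (fun t => cos (k * t)).
Proof.
apply: (@abs_cont_on_bounded_derive _ _ _ _ `|k| (is_derive_cosM k)) => x.
by rewrite normrN normrM ler_piMr// sin_max.
Qed.

Lemma abs_cont_on_sinM k a b : abs_cont_on a b (fun t => sin (k * t)).
Proof.
apply: (@abs_cont_on_bounded_derive _ _ _ _ `|k| (is_derive_sinM k)) => x.
by rewrite normrM ler_piMr// cos_max.
Qed.

End absolute_continuity.

#[local] Instance lebesgue_ae_filter (R : realType) :
  Filter (almost_everywhere (@lebesgue_measure R)).
Proof. exact: ae_filter_ringOfSetsType. Qed.

Section rotation.
Variable R : realType.
Local Notation mu := (@lebesgue_measure R).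
Implicit Types (a b k : R) (f g : R -> R).

Lemma rotation_ode_conserved k a b f g : a <= b ->
  abs_cont_on a b f -> abs_cont_on a b g ->
  {ae mu, forall t, t \in `]a, b[%R -> is_derive t 1 f (k * g t)} ->
  {ae mu, forall t, t \in `]a, b[%R -> is_derive t 1 g (- (k * f t))} ->
  f b * cos (k * b) - g b * sin (k * b) = f a * cos (k * a) - g a * sin (k * a).
Proof.
move=> ab acf acg df dg.
pose P t := f t * cos (k * t) + -1 * (g t * sin (k * t)).
rewrite -[_ * sin (k * b)]mul1r -[_ * sin (k * a)]mul1r -!mulNr -/(P b) -/(P a).
apply: abs_cont_on_derive0_cst => //.
  apply: abs_cont_onD; first exact/abs_cont_onM/abs_cont_on_cosM.
  apply: abs_cont_onM; first exact: abs_cont_on_cst.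
  exact/abs_cont_onM/abs_cont_on_sinM.
apply: filterS2 df dg => t df dg tab; rewrite {}/P.
have := is_deriveD (is_deriveM (df tab) (is_derive_cosM k t))
  (is_deriveZ (-1) (is_deriveM (dg tab) (is_derive_sinM k t))).
by move=> /is_derive_eq; apply; rewrite /GRing.scale/=; ring.
Qed.

Lemma rotation_ode k a b f g : a <= b ->
  abs_cont_on a b f -> abs_cont_on a b g ->
  {ae mu, forall t, t \in `]a, b[%R -> is_derive t 1 f (k * g t)} ->
  {ae mu, forall t, t \in `]a, b[%R -> is_derive t 1 g (- (k * f t))} ->
  f b = f a * cos (k * (b - a)) + g a * sin (k * (b - a)).
Proof.
move=> ab acf acg df dg.
have fE := rotation_ode_conserved ab acf acg df dg.
have gE : g b * cos (- k * b) - f b * sin (- k * b) =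
    g a * cos (- k * a) - f a * sin (- k * a).
  apply: rotation_ode_conserved => //.
    by apply: filterS dg => t + tab => /(_ tab); rewrite mulNr.
  by apply: filterS df => t + tab => /(_ tab); rewrite mulNr opprK.
move: gE; rewrite !mulNr !cosN !sinN => gE.
transitivity ((f b * cos (k * b) - g b * sin (k * b)) * cos (k * b) +
    (g b * cos (k * b) - f b * - sin (k * b)) * sin (k * b)).
  by rewrite -[LHS]mulr1 -(cos2Dsin2 (k * b)); ring.
by rewrite fE gE mulrBr cosB sinB; ring.
Qed.

End rotation.

Section linear_arcs.
Variable R : realType.
Local Notation mu := (@lebesgue_measure R).
Implicit Types (k l r t T : R) (u v : 'cV[R]_3) (A : 'M[R]_3) (x : R -> 'cV[R]_3).

Lemma ipE u v : ip u v = (u^T *m v) 0 0.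
Proof. by rewrite mxE; apply: eq_bigr => i _; rewrite mxE. Qed.

Lemma ipDl u1 u2 v : ip (u1 + u2) v = ip u1 v + ip u2 v.
Proof. by rewrite !ipE linearD/= mulmxDl mxE. Qed.

Lemma ipZl k u v : ip (k *: u) v = k * ip u v.
Proof. by rewrite !ipE linearZ/= -scalemxAl mxE. Qed.

Lemma ipNl u v : ip (- u) v = - ip u v.
Proof. by rewrite -scaleN1r ipZl mulN1r. Qed.

Lemma ipC u v : ip u v = ip v u.
Proof. by apply: eq_bigr => i _; rewrite mulrC. Qed.

Lemma ip0l v : ip 0 v = 0.
Proof. by rewrite -(scale0r (0 : 'cV[R]_3)) ipZl mul0r. Qed.

Lemma ip_skewsymmetric A u v : A^T = - A -> ip u (A *m v) = - ip (A *m u) v.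
Proof. by move=> skA; rewrite -ipNl !ipE -mulNmx -skA trmx_mul trmxK mulmxA. Qed.

Definition linear_arc A l r x : Prop :=
  (forall i, abs_cont_on l r (fun t => x t i 0)) /\
  {ae mu, forall t, t \in `]l, r[%R ->
    forall i, is_derive t 1 (fun s => x s i 0) ((A *m x t) i 0)}.

Lemma solves_linear_arc T (M : R -> 'M[R]_3) A l r x : solves T M x ->
  0 <= l -> r <= T -> (forall t, l < t < r -> M t = A) -> linear_arc A l r x.
Proof.
move=> [acx dx] l0 rT MA; split=> [i|]; first exact: abs_cont_onS (acx i).
apply: filterS dx => t dx; rewrite in_itv/= => /andP[lt_ tr] i.
have [|dxi dxiE] := dx _ i; first by rewrite in_itv/=; apply/andP; split; lra.
by apply: DeriveDef => //; rewrite -derive1E dxiE MA// lt_.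
Qed.

Lemma linear_arcSr A l r r' x : r' <= r -> linear_arc A l r x -> linear_arc A l r' x.
Proof.
move=> rr' [acx dx]; split=> [i|]; first exact: abs_cont_onS (acx i).
apply: filterS dx => t dx; rewrite in_itv/= => /andP[lt_ tr]; apply: dx.
by rewrite in_itv/= lt_ (lt_le_trans tr).
Qed.

Lemma abs_cont_on_ip A l r x u : linear_arc A l r x ->
  abs_cont_on l r (fun t => ip u (x t)).
Proof.
move=> [acx _]; apply: abs_cont_on_sum => i.
by apply: abs_cont_onM => //; exact: abs_cont_on_cst.
Qed.

Lemma is_derive_ip A l r x u : linear_arc A l r x ->
  {ae mu, forall t, t \in `]l, r[%R ->
    is_derive t 1 (fun s => ip u (x s)) (ip u (A *m x t))}.
Proof.
move=> [_ dx]; apply: filterS dx => t dx /dx{}dx.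
have := is_derive_sum (fun i => is_deriveZ (u i 0) (dx i)).
congr is_derive; apply/funext => s; rewrite /ip fct_sumE.
by apply: eq_bigr.
Qed.

Lemma linear_arc_kernel A l r x u : A^T = - A -> A *m u = 0 -> l <= r ->
  linear_arc A l r x -> ip u (x r) = ip u (x l).
Proof.
move=> skA Au lr ax; apply: (abs_cont_on_derive0_cst lr (abs_cont_on_ip u ax)).
apply: filterS (is_derive_ip u ax) => t /[apply].
by rewrite ip_skewsymmetric// Au ip0l oppr0.
Qed.

Lemma linear_arc_rotation k A l r x u v : A^T = - A ->
  A *m u = - (k *: v) -> A *m v = k *: u -> l <= r -> linear_arc A l r x ->
  ip u (x r) = ip u (x l) * cos (k * (r - l)) + ip v (x l) * sin (k * (r - l)).
Proof.
move=> skA Au Av lr ax.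
apply: (rotation_ode lr (abs_cont_on_ip u ax) (abs_cont_on_ip v ax)).
  apply: filterS (is_derive_ip u ax) => t /[apply].
  by rewrite ip_skewsymmetric// Au ipNl ipZl opprK.
apply: filterS (is_derive_ip v ax) => t /[apply].
by rewrite ip_skewsymmetric// Av ipZl.
Qed.

End linear_arcs.

Section grover_generators.
Variable R : realType.
Implicit Types (g l r t : R) (v : 'cV[R]_3) (x psi p : R -> 'cV[R]_3).

Local Ltac expand_coordinates :=
  apply/colP => -[[|[|[|//]]] ?];
  rewrite !mxE ?/ip ?big_ord_recl ?big_ord0 ?mxE/=.

Definition e1 : 'cV[R]_3 := \col_(i < 3) (i == 0%N :> nat)%:R.
Definition e2 : 'cV[R]_3 := \col_(i < 3) (i == 1%N :> nat)%:R.
Definition X_axis g : 'cV[R]_3 := cos g *: e2 - sin g *: e3 R.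

Lemma psi0E g : psi0 g = sin g *: e2 + cos g *: e3 R.
Proof. by expand_coordinates; ring. Qed.

Lemma e3E g : e3 R = cos g *: psi0 g - sin g *: X_axis g.
Proof. by expand_coordinates; ring: (sin2cos2 g). Qed.

Lemma Xmat_skew g : (Xmat g)^T = - Xmat g.
Proof.
by apply/matrixP => -[[|[|[|//]]] ?] [[|[|[|//]]] ?]; rewrite !mxE/= ?oppr0 ?opprK.
Qed.

Lemma Ymat_skew : (Ymat R)^T = - Ymat R.
Proof.
by apply/matrixP => -[[|[|[|//]]] ?] [[|[|[|//]]] ?]; rewrite !mxE/= ?oppr0 ?opprK.
Qed.

Lemma Xmat_e1 g : Xmat g *m e1 = - (sin g *: psi0 g).
Proof. by expand_coordinates; ring. Qed.

Lemma Xmat_psi0 g : Xmat g *m psi0 g = sin g *: e1.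
Proof. by expand_coordinates; ring: (sin2cos2 g). Qed.

Lemma Xmat_axis g : Xmat g *m X_axis g = 0.
Proof. by expand_coordinates; ring. Qed.

Lemma Ymat_e1 : Ymat R *m e1 = - (1 *: e2).
Proof. by expand_coordinates; ring. Qed.

Lemma Ymat_e2 : Ymat R *m e2 = 1 *: e1.
Proof. by expand_coordinates; ring. Qed.

Lemma Ymat_e3 : Ymat R *m e3 R = 0.
Proof. by expand_coordinates; ring. Qed.

Lemma F1_mulE g v :
  F1 g *m v = cos g *: (ip e1 v *: X_axis g - ip (X_axis g) v *: e1).
Proof. by expand_coordinates; ring: (sin2cos2 g). Qed.

Lemma phi1E g psi p t : phi1 g psi p t = cos g *
  (ip (X_axis g) (p t) * ip e1 (psi t) - ip e1 (p t) * ip (X_axis g) (psi t)).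
Proof. by rewrite /phi1 ipC F1_mulE ipZl ipDl ipNl !ipZl !(ipC _ (p t)); ring. Qed.

Lemma ip_e1_psi0 g : ip e1 (psi0 g) = 0.
Proof. by rewrite /ip !big_ord_recl big_ord0 !mxE/=; ring. Qed.

Lemma ip_e2_psi0 g : ip e2 (psi0 g) = sin g.
Proof. by rewrite /ip !big_ord_recl big_ord0 !mxE/=; ring. Qed.

Lemma ip_e3_psi0 g : ip (e3 R) (psi0 g) = cos g.
Proof. by rewrite /ip !big_ord_recl big_ord0 !mxE/=; ring. Qed.

Lemma ip_axis_psi0 g : ip (X_axis g) (psi0 g) = 0.
Proof. by rewrite ipDl ipNl !ipZl ip_e2_psi0 ip_e3_psi0; ring. Qed.

Lemma phi1_psi0 g psi p t : psi t = psi0 g -> phi1 g psi p t = 0.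
Proof. by move=> psit; rewrite phi1E psit ip_e1_psi0 ip_axis_psi0; ring. Qed.

End grover_generators.
Arguments e1 {R}.
Arguments e2 {R}.

Section grover_arcs.
Variable R : realType.
Implicit Types (g l r t : R) (x psi p : R -> 'cV[R]_3).

Lemma X_arc_e1 g l r x : l <= r -> linear_arc (Xmat g) l r x ->
  ip e1 (x r) = ip e1 (x l) * cos (sin g * (r - l)) +
    ip (psi0 g) (x l) * sin (sin g * (r - l)).
Proof. exact: linear_arc_rotation (Xmat_skew g) (Xmat_e1 g) (Xmat_psi0 g). Qed.

Lemma X_arc_psi0 g l r x : l <= r -> linear_arc (Xmat g) l r x ->
  ip (psi0 g) (x r) = ip (psi0 g) (x l) * cos (sin g * (r - l)) -
    ip e1 (x l) * sin (sin g * (r - l)).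
Proof.
move=> lr ax; rewrite -mulrN -sinN -cosN -mulNr.
apply: linear_arc_rotation (Xmat_skew g) _ _ lr ax.
  by rewrite scaleNr opprK Xmat_psi0.
by rewrite scaleNr Xmat_e1.
Qed.

Lemma X_arc_axis g l r x : l <= r -> linear_arc (Xmat g) l r x ->
  ip (X_axis g) (x r) = ip (X_axis g) (x l).
Proof. exact: linear_arc_kernel (Xmat_skew g) (Xmat_axis g). Qed.

Lemma Y_arc_e1 l r x : l <= r -> linear_arc (Ymat R) l r x ->
  ip e1 (x r) = ip e1 (x l) * cos (r - l) + ip e2 (x l) * sin (r - l).
Proof.
rewrite -[r - l]mul1r.
exact: linear_arc_rotation (Ymat_skew R) (Ymat_e1 R) (Ymat_e2 R).
Qed.

Lemma Y_arc_e2 l r x : l <= r -> linear_arc (Ymat R) l r x ->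
  ip e2 (x r) = ip e2 (x l) * cos (r - l) - ip e1 (x l) * sin (r - l).
Proof.
move=> lr ax; rewrite -mulrN -sinN -cosN -mulN1r.
apply: linear_arc_rotation (Ymat_skew R) _ _ lr ax.
  by rewrite scaleN1r opprK -[e1]scale1r Ymat_e2.
by rewrite scaleNr Ymat_e1.
Qed.

Lemma Y_arc_e3 l r x : l <= r -> linear_arc (Ymat R) l r x ->
  ip (e3 R) (x r) = ip (e3 R) (x l).
Proof. exact: linear_arc_kernel (Ymat_skew R) (Ymat_e3 R). Qed.

Lemma phi1_X_arc g l r psi p : l <= r ->
  linear_arc (Xmat g) l r psi -> linear_arc (Xmat g) l r p ->
  phi1 g psi p r = phi1 g psi p l * cos (sin g * (r - l)) + cos g *
    (ip (X_axis g) (p l) * ip (psi0 g) (psi l)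
     - ip (psi0 g) (p l) * ip (X_axis g) (psi l)) * sin (sin g * (r - l)).
Proof.
move=> lr apsi ap; rewrite !phi1E (X_arc_e1 lr apsi) (X_arc_axis lr apsi).
by rewrite (X_arc_e1 lr ap) (X_arc_axis lr ap); ring.
Qed.

Lemma X_arc_between_zeros g l t r psi p : 0 < sin g -> l <= t <= r ->
  linear_arc (Xmat g) l r psi -> linear_arc (Xmat g) l r p ->
  phi1 g psi p l = 0 -> phi1 g psi p t != 0 -> phi1 g psi p r = 0 ->
  pi <= sin g * (r - l).
Proof.
move=> s0 /andP[lt_ tr] apsi ap pl pt pr; rewrite leNgt; apply/negP => srl.
have ltr : l < r.
  rewrite (lt_le_trans _ tr)// lt_neqAle lt_ andbT.
  by apply: contraNneq pt => <-; rewrite pl.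
have := phi1_X_arc (ltW ltr) apsi ap.
rewrite pl pr mul0r add0r => /esym/eqP; rewrite mulf_eq0 => /orP[/eqP K0|].
  have := phi1_X_arc lt_ (linear_arcSr tr apsi) (linear_arcSr tr ap).
  by rewrite pl K0 !mul0r addr0; exact/eqP.
by rewrite gt_eqF// sin_gt0_pi// srl andbT mulr_gt0// subr_gt0.
Qed.

End grover_arcs.

Section X_orbit.
Variable R : realType.
Implicit Types (g t T : R).

Definition X_orbit g t : 'cV[R]_3 :=
  sin (sin g * t) *: e1 + cos (sin g * t) *: psi0 g.

Lemma X_orbit_coord g t i :
  X_orbit g t i 0 = sin (sin g * t) * e1 i 0 + cos (sin g * t) * psi0 g i 0.
Proof. by rewrite !mxE. Qed.

Lemma Xmat_X_orbit_coord g t i : (Xmat g *m X_orbit g t) i 0 =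
  sin g * cos (sin g * t) * e1 i 0 + - (sin g * sin (sin g * t)) * psi0 g i 0.
Proof.
by rewrite mulmxDr -!scalemxAr Xmat_e1 Xmat_psi0 mxE addrC !mxE; ring.
Qed.

Lemma X_orbit_trajectory g T : 0 <= T ->
  trajectory g T [::] [:: true] (X_orbit g).
Proof.
move=> T0; split; first by split.
split; last by rewrite /X_orbit mulr0 sin0 cos0 scale0r scale1r add0r.
split=> [i|].
  under eq_fun do rewrite X_orbit_coord.
  exact: (abs_cont_onD
    (abs_cont_onM (abs_cont_on_sinM (sin g) 0 T) (abs_cont_on_cst 0 T (e1 i 0)))
    (abs_cont_onM (abs_cont_on_cosM (sin g) 0 T) (abs_cont_on_cst 0 T (psi0 g i 0)))).
apply: aeW => t _ i; rewrite derive1E.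
suff orbitX : is_derive t 1 (fun s => X_orbit g s i 0) ((Xmat g *m X_orbit g t) i 0).
  by case: orbitX.
under eq_fun do rewrite X_orbit_coord.
have := is_deriveD
  (is_deriveM (is_derive_sinM (sin g) t) (is_derive_cst (e1 i 0 : R) t 1))
  (is_deriveM (is_derive_cosM (sin g) t) (is_derive_cst (psi0 g i 0 : R) t 1)).
move=> /is_derive_eq; apply.
by rewrite Xmat_X_orbit_coord /cst/= /GRing.scale/=; ring.
Qed.

Lemma X_orbit_inSigma g : sin g != 0 -> inSigma (X_orbit g (pi / 2 / sin g)).
Proof.
move=> s0; rewrite /inSigma ipC ipDl !ipZl (mulrC (sin g)) divfK//.
rewrite cos_pihalf mul0r addr0.
by rewrite ipC /ip !big_ord_recl big_ord0 !mxE/=; ring.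
Qed.

Lemma time_optimal_le g T : 0 < sin g -> time_optimal g T -> sin g * T <= pi / 2.
Proof.
move=> s0 opt; rewrite mulrC -ler_pdivlMr//.
apply: opt (X_orbit_trajectory g _) (X_orbit_inSigma _); last by rewrite gt_eqF.
by rewrite !divr_ge0// ?pi_ge0// ltW.
Qed.

End X_orbit.

Section YX_height.
Variable R : realType.
Implicit Types (k x t : R).

Definition YX_height k x t : R :=
  cos (k * t) + k ^+ 2 * (1 - cos (k * t)) * (1 - cos x)
  - k * sin x * sin (k * t).

Lemma mul_sin_le_sin_mul_pihalf k x : 0 <= k <= 1 -> 0 <= x <= pi / 2 ->
  k * sin x <= sin (k * x).
Proof.
move=> /andP[k0 k1] /andP[x0 xpi]; rewrite -subr_ge0.
pose f y := sin (k * y) - k * sin y; pose df y := k * (cos (k * y) - cos y).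
have dfE (y : R) : is_derive y 1 f (df y).
  have := is_deriveB (is_derive_sinM k y) (is_deriveZ k (is_derive_sin y)).
  by move=> /is_derive_eq; apply; rewrite /df /GRing.scale/= mulrBr.
have [y] := is_derive_MVT x0 dfE; rewrite in_itv/= => /andP[y0 yx].
rewrite /f !mulr0 sin0 mulr0 !subr0 => ->.
have kyy : k * y <= y by rewrite ler_piMl.
have ky0 : 0 <= k * y by rewrite mulr_ge0.
rewrite mulr_ge0// mulr_ge0// subr_ge0 leNgt ltr_cos ?in_itv/= ?ltNge ?kyy//;
  have := pi_gt0 R; lra.
Qed.

Lemma mul_sin_le_sin_mul k x : 0 <= k <= 1 -> 0 <= x -> k * x <= pi / 2 ->
  k * sin x <= sin (k * x).
Proof.
move=> k01 x0 kx; have [xpi|pix] := leP x (pi / 2).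
  by apply: mul_sin_le_sin_mul_pihalf => //; rewrite x0.
have /andP[k0 k1] := k01; have pi0 := pi_gt0 R.
apply: (@le_trans _ _ (k * sin (pi / 2))).
  by rewrite ler_wpM2l// sin_pihalf sin_le1.
apply: (@le_trans _ _ (sin (k * (pi / 2)))).
  by apply: mul_sin_le_sin_mul_pihalf => //; lra.
have kpi : k * (pi / 2) <= k * x by rewrite ler_wpM2l// ltW.
have kpi0 : 0 <= k * (pi / 2) by rewrite mulr_ge0//; lra.
by rewrite leNgt ltr_sin ?in_itv/= -?leNgt//; lra.
Qed.

Lemma YX_height_gt0 k x t : 0 < k <= 1 -> 0 < x -> 0 <= t ->
  k * (x + t) <= pi / 2 -> 0 < YX_height k x t.
Proof.
move=> /andP[k0 k1] x0 t0; rewrite mulrDr => kxt.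
have kx0 : 0 < k * x by rewrite mulr_gt0.
have kt0 : 0 <= k * t by rewrite mulr_ge0// ltW.
have pi0 := pi_gt0 R.
have sinx : k * sin x <= sin (k * x).
  by apply: mul_sin_le_sin_mul; rewrite ?(ltW k0)//; lra.
have sinkt0 : 0 <= sin (k * t) by apply: sin_ge0_pi; lra.
have sinkx0 : 0 < sin (k * x) by apply: sin_gt0_pi; lra.
have sin_le_cos : sin (k * x) <= cos (k * t).
  rewrite -cosBpihalf -cosN opprB leNgt ltr_cos ?in_itv/= -?leNgt; lra.
have sinkt1 : sin (k * t) < 1.
  rewrite -sin_pihalf ltr_sin ?in_itv/=; lra.
have := ler_wpM2r sinkt0 sinx.
have : 0 <= k ^+ 2 * (1 - cos (k * t)) * (1 - cos x).
  by rewrite mulr_ge0 ?subr_ge0 ?cos_le1// mulr_ge0 ?sqr_ge0 ?subr_ge0 ?cos_le1.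
have : 0 < sin (k * x) * (1 - sin (k * t)) by rewrite mulr_gt0// subr_gt0.
rewrite /YX_height mulrBr mulr1; lra.
Qed.

End YX_height.

Section switching_structure.
Variable R : realType.
Implicit Types (g l m r t T : R) (ts : seq R) (bs : seq bool).
Implicit Types (x psi p : R -> 'cV[R]_3).

Lemma YX_arcs_e3 g l m r x : l <= m -> m <= r -> x l = psi0 g ->
  linear_arc (Ymat R) l m x -> linear_arc (Xmat g) m r x ->
  ip (e3 R) (x r) = cos g * YX_height (sin g) (m - l) (r - m).
Proof.
move=> lm mr xl aY aX.
rewrite {1}(e3E g) ipDl ipNl !ipZl (X_arc_psi0 mr aX) (X_arc_axis mr aX).
rewrite psi0E /X_axis !ipDl !ipNl !ipZl.
rewrite (Y_arc_e1 lm aY) (Y_arc_e2 lm aY) (Y_arc_e3 lm aY) xl.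
rewrite ip_e1_psi0 ip_e2_psi0 ip_e3_psi0.
by rewrite /YX_height; ring: (sin2cos2 g).
Qed.

(* The arcs are [knot k, knot k.+1] for k <= size ts: the default value T of nth
   ends the last one. *)
Definition knot T ts k : R := nth T (0 :: ts) k.

Lemma count_lt_path (a : R) T ts k t : path <%R a ts -> (k <= size ts)%N ->
  nth T (a :: ts) k < t <= nth T ts k -> count (fun s => s < t) ts = k.
Proof.
elim: ts a k => [|b ts ih] a k /=; first by rewrite leqn0 => _ /eqP.
case: k => [|k] /andP[_ bts] kts /= /andP[kt tk].
  apply/eqP; rewrite ltNge tk add0n -leqn0 leqNgt -has_count; apply/hasPn => s.
  by move=> /(allP (lt_path_min bts)) bs; rewrite -leNgt (le_trans tk)// ltW.
rewrite (ih b k)// ?kt// (le_lt_trans _ kt)//.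
by rewrite -[leLHS]/(nth T (b :: ts) 0) lt_sorted_leq_nth.
Qed.

Lemma ctrl_knot g T ts bs k t : admissible T ts bs -> (k <= size ts)%N ->
  knot T ts k < t < knot T ts k.+1 ->
  ctrl g ts bs t = if nth false bs k then Xmat g else Ymat R.
Proof.
move=> [_ _ pts _] kts /andP[kt tk]; rewrite /ctrl /label (@count_lt_path 0 T _ k)//.
by apply/andP; split; [exact: kt|exact: ltW].
Qed.

Lemma ctrl_skew g ts bs t : (ctrl g ts bs t)^T = - ctrl g ts bs t.
Proof. by rewrite /ctrl; case: ifP; rewrite (Xmat_skew, Ymat_skew). Qed.

Lemma knot_bounds T ts bs k : admissible T ts bs -> 0 <= knot T ts k <= T.
Proof.
move=> [T0 _ pts /allP tsT]; have [kts|tsk] := ltnP k (size ts).+1; last first.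
  by rewrite /knot nth_default// T0 lexx.
case: k kts => [|k] kts; rewrite /knot/= ?lexx//.
by rewrite !ltW// ?tsT ?(allP (lt_path_min pts)) ?mem_nth.
Qed.

Lemma knot_lt T ts bs k : admissible T ts bs -> (k < size ts)%N ->
  knot T ts k < knot T ts k.+1.
Proof. by move=> [_ _ /(pathP T)/(_ k) + _]; apply. Qed.

Lemma solves_knot_arc g T ts bs k x : admissible T ts bs -> (k <= size ts)%N ->
  solves T (ctrl g ts bs) x ->
  linear_arc (if nth false bs k then Xmat g else Ymat R)
    (knot T ts k) (knot T ts k.+1) x.
Proof.
move=> adm kts solx; apply: solves_linear_arc solx _ _ _.
- by have /andP[] := knot_bounds k adm.
- by have /andP[] := knot_bounds k.+1 adm.
- by move=> t; exact: ctrl_knot.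
Qed.

Lemma phi1_knot g T ts psi p k : psi 0 = psi0 g -> regular g T ts psi p ->
  (k <= size ts)%N -> phi1 g psi p (knot T ts k) = 0.
Proof.
move=> psi00 [_ switch]; case: k => [|k] kts; first exact: phi1_psi0.
by have [] := switch (nth T ts k) (mem_nth T kts).
Qed.

Lemma regular_phi1_neq0 g T ts psi p l r : regular g T ts psi p ->
  0 <= l -> l < r -> r <= T -> exists2 t, l <= t <= r & phi1 g psi p t != 0.
Proof.
move=> [isol _] l0 lr rT; have [pl|pl] := eqVneq (phi1 g psi p l) 0; last first.
  by exists l; rewrite ?lexx ?ltW.
have [|e e0 phi1_neq0] := isol l _ pl.
  by rewrite in_itv/= l0 (le_trans (ltW lr)).
pose t := Num.min r (l + e / 2).
have lt_ : l < t by rewrite lt_min lr ltrDl divr_gt0.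
have tr : t <= r by rewrite ge_min lexx.
have te : t < l + e by rewrite gt_min; apply/orP; right; lra.
exists t; first by rewrite ltW.
apply: phi1_neq0; first by rewrite in_itv/=; lra.
by rewrite gtr0_norm ?subr_gt0// lt_ ltrBlDl.
Qed.

Lemma X_arc_before_switching_ge g T ts bs psi p k : 0 < sin g ->
  normal_extremal g T ts bs psi p -> regular g T ts psi p ->
  (k < size ts)%N -> nth false bs k ->
  pi <= sin g * (knot T ts k.+1 - knot T ts k).
Proof.
move=> s0 [[[adm [solpsi psi00]] _] _ solp _ _] reg kts Xk.
have costate : solves T (ctrl g ts bs) p.
  rewrite (_ : ctrl g ts bs = fun t => - (ctrl g ts bs t)^T)//.
  by apply/funext => t; rewrite ctrl_skew opprK.
have /andP[l0 _] := knot_bounds k adm; have /andP[_ rT] := knot_bounds k.+1 adm.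
have [t tlr phi1t] := regular_phi1_neq0 reg l0 (knot_lt adm kts) rT.
have := solves_knot_arc adm (ltnW kts) solpsi.
have := solves_knot_arc adm (ltnW kts) costate.
rewrite Xk => arcp arcpsi; apply: X_arc_between_zeros tlr arcpsi arcp _ phi1t _ => //.
  by apply: phi1_knot reg _ => //; exact: ltnW.
exact: phi1_knot reg _.
Qed.

Lemma YX_trajectory_e3_gt0 g T tau psi : 0 < sin g -> 0 < cos g ->
  sin g * T <= pi / 2 -> trajectory g T [:: tau] [:: false; true] psi ->
  0 < ip (e3 R) (psi T).
Proof.
move=> s0 c0 sT [adm [solpsi psi00]].
have tau0 : 0 < tau := knot_lt (k := 0) adm isT.
have /andP[_ tauT] : 0 <= tau <= T := knot_bounds 1 adm.
have arcY := solves_knot_arc (k := 0) adm isT solpsi.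
have arcX := solves_knot_arc (k := 1) adm isT solpsi.
rewrite (YX_arcs_e3 (ltW tau0) tauT psi00 arcY arcX) mulr_gt0// subr0.
by rewrite YX_height_gt0 ?s0 ?sin_le1 ?subr_ge0 ?subrKC.
Qed.

Lemma Y_trajectory_e3 g T psi : trajectory g T [::] [:: false] psi ->
  ip (e3 R) (psi T) = cos g.
Proof.
move=> [adm [solpsi psi00]]; have [T0 _ _ _] := adm.
have arcY := solves_knot_arc (k := 0) adm isT solpsi.
by rewrite (Y_arc_e3 T0 arcY) psi00 ip_e3_psi0.
Qed.

Lemma Y_arc_before_switching g T ts bs psi p k : 0 < sin g ->
  normal_extremal g T ts bs psi p -> regular g T ts psi p -> time_optimal g T ->
  (k < size ts)%N -> nth false bs k = false.
Proof.
move=> s0 ext reg opt kts; apply/negP => /(X_arc_before_switching_ge s0 ext reg kts).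
have [[[adm _] _] _ _ _ _] := ext; have := time_optimal_le s0 opt.
have /andP[l0 _] := knot_bounds k adm; have /andP[_ rT] := knot_bounds k.+1 adm.
have : sin g * (knot T ts k.+1 - knot T ts k) <= sin g * T by rewrite ler_pM2l//; lra.
by have := pi_gt0 R; lra.
Qed.

Theorem regular_time_optimal_control g T ts bs psi p : 0 < g < pi / 2 ->
  normal_extremal g T ts bs psi p -> regular g T ts psi p -> time_optimal g T ->
  ts = [::] /\ bs = [:: true].
Proof.
move=> g0 ext reg opt; have pi0 := pi_gt0 R.
have s0 : 0 < sin g by exact: sin_gt0_pihalf.
have c0 : 0 < cos g by apply: cos_gt0_pihalf; lra.
have Y_before k := Y_arc_before_switching (k := k) s0 ext reg opt.
have [[traj alt] sigma _ _ _] := ext; have [[_ sizebs _ _] _] := traj.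
case: ts bs => [|t1 [|t2 ts]] [|b0 [|b1 bs]]//=
  in sizebs Y_before traj alt {ext reg} *.
- case: b0 traj {alt Y_before} => // /Y_trajectory_e3.
  by rewrite sigma => c_eq0; rewrite -c_eq0 ltxx in c0.
- have b0F : b0 = false by exact: Y_before 0%N isT.
  have b1T : b1 = true by have := alt 0%N isT; rewrite b0F; case: (b1).
  rewrite {}b0F {}b1T (size0nil (succn_inj (succn_inj sizebs))) in traj.
  have := YX_trajectory_e3_gt0 s0 c0 (time_optimal_le s0 opt) traj.
  by rewrite sigma ltxx.
- by have := alt 0%N isT; rewrite /= [b0](Y_before 0%N isT) [b1](Y_before 1%N isT).
Qed.

End switching_structure.

Theorem mainTheorem13 (R : realType) (g T : R) (ts : seq R) (bs : seq bool)
    (psi p : R -> 'cV[R]_3) :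
  0 < g < pi / 2 ->
  normal_extremal g T ts bs psi p ->
  regular g T ts psi p ->
  time_optimal g T ->
  (size ts <= 2)%N /\ (bs = [:: true] \/ bs = [:: true; false; true]).
Proof.
move=> g0 ext reg opt.
have [-> ->] := regular_time_optimal_control g0 ext reg opt.
by split; [|left].
Qed.
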